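(* There is an absolute constant $c>0$ with the following property. Let $\mathbf{G}$ be an abelian group and let $A\subseteq\mathbf{G}$ be a finite nonempty set. Define $K$ and $M$ by $\mathsf{E}_{3/2}(A)=|A|^{5/2}/K^{1/2}$ and $\mathsf{T}_4(A)=M|A|^7/K^3$. Then there is a set $A'\subseteq A$ such that $$|A'|\ge c\,\frac{|A|}{MK}\qquad\text{and}\qquad \mathsf{E}(A')\ge c\,\frac{|A'|^3}{M}.$$
   Context: For a finite set $A\subseteq\mathbf{G}$ and real $s\ge1$, $\mathsf{E}_s(A)=\sum_x |A\cap(A-x)|^s$, where the sum is over $x$ with $A\cap (A-x)\ne\emptyset$; $\mathsf{E}(A)=\mathsf{E}_2(A)$ is the additive energy. $\mathsf{T}_4(A)$ is the number of solutions of $a_1+a_2+a_3+a_4=a_1'+a_2'+a_3'+a_4'$ with all $a_i,a_i'\in A$. *)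

(* Defs.v *)
From HB Require Import structures.
From mathcomp Require Import all_boot all_order all_algebra.
From mathcomp Require Import finmap.
From mathcomp Require Import all_classical all_reals all_analysis.

Set Implicit Arguments.
Unset Strict Implicit.
Unset Printing Implicit Defensive.

Import Order.TTheory GRing.Theory Num.Theory.
Local Open Scope fset_scope.
Local Open Scope ring_scope.

Definition fshift (G : zmodType) (A : {fset G}) (x : G) : {fset G} :=
  [fset a - x | a in A].

Definition overlap (G : zmodType) (A : {fset G}) (x : G) : {fset G} :=
  A `&` fshift A x.

(* [\sum_(x \in S)] is 0 by convention when the summand has infinite support
   in S; [finite_overlap] shows that this never happens here. *)
Definition energy (R : realType) (G : zmodType) (s : R) (A : {fset G}) : R :=
  \sum_(x \in [set x : G | overlap A x != fset0%fset]%classic)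
     #|` overlap A x|%:R `^ s.

Definition T_energy (G : zmodType) (k : nat) (A : {fset G}) : nat :=
  #|[set p : {ffun 'I_k -> A} * {ffun 'I_k -> A} |
      \sum_(i < k) val (p.1 i) == \sum_(i < k) val (p.2 i)]%SET|.

Lemma overlap_neq0 (G : zmodType) (A : {fset G}) (x : G) :
  (overlap A x != fset0) = (x \in [fset a - b | a in A, b in A]).
Proof.
apply/fset0Pn/imfset2P => [[b]|[a aA [b bA ->]]].
  rewrite /overlap inE => /andP[bA /imfsetP[a /= aA bE]].
  by exists a => //; exists b => //; rewrite bE opprB addrC subrK.
exists b; rewrite /overlap inE; apply/andP; split=> //.
by apply/imfsetP; exists a => //; rewrite opprB addrC subrK.
Qed.

Lemma finite_overlap (G : zmodType) (A : {fset G}) :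
  finite_set [set x : G | overlap A x != fset0%fset]%classic.
Proof.
have -> : [set x : G | overlap A x != fset0%fset]%classic =
          [set` [fset a - b | a in A, b in A]%fset]%classic.
  by apply/seteqP; split=> x /=; rewrite overlap_neq0.
exact: finite_fset.
Qed.

Lemma energyE (R : realType) (G : zmodType) (s : R) (A : {fset G}) :
  energy s A = \sum_(x <- [fset a - b | a in A, b in A])
                 #|` overlap A x|%:R `^ s.
Proof.
rewrite (fsbig_seq _ _ (fset_uniq _)) /energy.
by apply: eq_fsbigl; apply/seteqP; split=> x /=; rewrite overlap_neq0.
Qed.

(* Main.v *)
(** Write r(x) for the size of A_x = A ∩ (A - x). The matrix r(b - a)^(1/2),
    with a, b in A, has total mass E_{3/2}(A), so by Cauchy-Schwarz it has
    weighted 4-cycle count W >= E_{3/2}(A)^4 / |A|^4. A second Cauchy-Schwarz,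
    grouping the 4-cycles by their edge differences, gives W^2 <= E_4(A) T_4(A).
    Since r(d)^2 is the sum over x of |A_x ∩ (A_x - d)|, Minkowski bounds
    E_4(A)^(1/2) by the sum of E(A_x)^(1/2). Hence
      sum_x E(A_x)^(1/2) >= M^(-1/2) sum_x r(x)^(3/2),
    and the x with r(x) < c |A| / (M K) contribute little because
    E(A_x) <= r(x)^3; so A' = A_x works for some remaining x. *)
Require Import Defs.
From HB Require Import structures.
From mathcomp Require Import all_boot all_order all_algebra.
From mathcomp Require Import finmap.
From mathcomp Require Import all_classical all_reals all_analysis.
From mathcomp Require Import ring lra.

Set Implicit Arguments.
Unset Strict Implicit.
Unset Printing Implicit Defensive.

Import Order.TTheory GRing.Theory Num.Theory.
Local Open Scope fset_scope.
Local Open Scope ring_scope.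

(** * Cauchy-Schwarz and double counting for finite sums *)

Lemma sum_cauchy_schwarz (R : realFieldType) (I : Type) (s : seq I)
    (f g : I -> R) :
  (\sum_(i <- s) f i * g i) ^+ 2 <=
  (\sum_(i <- s) f i ^+ 2) * (\sum_(i <- s) g i ^+ 2).
Proof.
(* Lagrange's identity: this double sum is twice the gap between the two sides. *)
have : 0 <= \sum_(i <- s) \sum_(j <- s) (f i * g j - f j * g i) ^+ 2.
  by do 2 (apply: sumr_ge0 => ? _); rewrite sqr_ge0.
have -> : \sum_(i <- s) \sum_(j <- s) (f i * g j - f j * g i) ^+ 2 =
    2 * ((\sum_(i <- s) f i ^+ 2) * (\sum_(i <- s) g i ^+ 2))
    - 2 * (\sum_(i <- s) f i * g i) ^+ 2.
  have -> : 2 * ((\sum_(i <- s) f i ^+ 2) * (\sum_(i <- s) g i ^+ 2)) =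
      (\sum_(i <- s) f i ^+ 2) * (\sum_(i <- s) g i ^+ 2) +
      (\sum_(i <- s) g i ^+ 2) * (\sum_(i <- s) f i ^+ 2) by ring.
  rewrite (expr2 (\sum_(i <- s) _)) !big_distrlr /= big_distrr /=.
  rewrite -big_split /= -sumrB; apply: eq_bigr => i _.
  rewrite big_distrr /= -big_split /= -sumrB; apply: eq_bigr => j _.
  ring.
by lra.
Qed.

Lemma sqr_sum_le_card (R : realFieldType) (I : finType) (f : I -> R) :
  (\sum_i f i) ^+ 2 <= #|I|%:R * \sum_i f i ^+ 2.
Proof.
have := sum_cauchy_schwarz (index_enum I) (fun=> 1) f.
under eq_bigr do rewrite mul1r.
by rewrite [in X in X * _]expr1n sumr_const.
Qed.

(** Cauchy-Schwarz twice: first over the column sums, giving [V]; then [V] is expanded as a sum over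
    pairs of rows of their inner products and Cauchy-Schwarz is applied to the pairs. *)
Lemma sum_four_cycles_ge (R : realFieldType) (I : finType) (k : I -> I -> R) :
  (\sum_a \sum_b k a b) ^+ 4 <=
  #|I|%:R ^+ 4 * \sum_(p : I * I) (\sum_b k p.1 b * k p.2 b) ^+ 2.
Proof.
set S := \sum_a _; set W := \sum_p _.
pose V := \sum_b (\sum_a k a b) ^+ 2.
have SV : S ^+ 2 <= #|I|%:R * V.
  by rewrite /S exchange_big; exact: sqr_sum_le_card.
have VW : V ^+ 2 <= #|I|%:R ^+ 2 * W.
  have -> : V = \sum_(p : I * I) \sum_b k p.1 b * k p.2 b.
    rewrite exchange_big; apply: eq_bigr => b _.
    by rewrite expr2 big_distrlr pair_bigA.
  by rewrite -natrX -mulnn -card_prod; exact: sqr_sum_le_card.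
have V0 : 0 <= V by apply: sumr_ge0 => ? _; rewrite sqr_ge0.
apply: (@le_trans _ _ ((#|I|%:R * V) ^+ 2)).
  by rewrite (exprM S 2 2) lerXn2r ?nnegrE ?sqr_ge0 ?mulr_ge0.
by rewrite exprMn (exprM _ 2 2) (expr2 (_ ^+ 2)) -mulrA ler_wpM2l ?sqr_ge0.
Qed.

Lemma sum_delta (R : pzSemiRingType) (S : eqType) (s : seq S) (y : S)
    (f : S -> R) :
  uniq s -> y \in s -> \sum_(x <- s) (y == x)%:R * f x = f y.
Proof.
move=> us ys; rewrite (bigD1_seq y) //= eqxx mul1r big1 ?addr0 // => x.
by rewrite eq_sym => /negPf ->; rewrite mul0r.
Qed.

(** Grouping by the value of [sh] weights each [F s] by the size of its fibre; Cauchy-Schwarz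
    separates the two, and the squared fibre sizes count pairs with equal [sh]. *)
Lemma sum_fibers_sqr_le (R : realFieldType) (Q : finType) (S : eqType)
    (sh : Q -> S) (F : S -> R) :
  (\sum_q F (sh q)) ^+ 2 <=
  (\sum_q \sum_q' (sh q == sh q')%:R) *
  \sum_(s <- undup (codom sh)) F s ^+ 2.
Proof.
set U := undup _.
have shU q : sh q \in U by rewrite mem_undup codom_f.
have uU : uniq U by exact: undup_uniq.
have -> : \sum_q F (sh q) = \sum_(s <- U) (\sum_q (sh q == s)%:R) * F s.
  under [RHS]eq_bigr do rewrite big_distrl /=.
  by rewrite exchange_big; apply: eq_bigr => q _; rewrite sum_delta.
suff -> : \sum_q \sum_q' (sh q == sh q')%:R =
    \sum_(s <- U) (\sum_q (sh q == s)%:R) ^+ 2 :> R.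
  exact: sum_cauchy_schwarz.
under [RHS]eq_bigr do rewrite expr2 big_distrlr /=.
rewrite [RHS]exchange_big; apply: eq_bigr => q _.
rewrite [RHS]exchange_big; apply: eq_bigr => q' _.
by rewrite (sum_delta (fun s => (sh q' == s)%:R)) // eq_sym.
Qed.

Lemma sum_prod_mul (R : comPzSemiRingType) (I J : finType) (f : I -> R) (g : J -> R) :
  \sum_(p : I * J) f p.1 * g p.2 = (\sum_i f i) * \sum_j g j.
Proof. by rewrite big_distrlr pair_bigA. Qed.

Lemma sum2_prod_mul (R : comPzSemiRingType) (I J : finType) (f : I -> I -> R)
    (g : J -> J -> R) :
  \sum_(p : I * J) \sum_(q : I * J) f p.1 q.1 * g p.2 q.2 =
  (\sum_i \sum_i' f i i') * \sum_j \sum_j' g j j'.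
Proof.
under eq_bigr do rewrite sum_prod_mul.
exact: sum_prod_mul.
Qed.

(** * Overlaps, edge differences of 4-cycles, and T_4 *)

Section Overlaps.
Variables (G : zmodType).
Implicit Types (A B : {fset G}) (x d : G).

Lemma in_overlap A x a : (a \in overlap A x) = (a \in A) && (a + x \in A).
Proof.
rewrite /overlap inE; case: (a \in A) => //=.
apply/imfsetP/idP => [[b /= bA ->]|axA]; first by rewrite subrK.
by exists (a + x) => //; rewrite addrK.
Qed.

Lemma overlap_sub A x : overlap A x `<=` A.
Proof. exact: fsubsetIl. Qed.

Lemma overlapC A x d :
  overlap (overlap A x) d = overlap (overlap A d) x.
Proof.
apply/fsetP => a; rewrite !in_overlap addrAC.
by case: (a \in A) (a + x \in A) (a + d \in A) => [] [] [].
Qed.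

Lemma card_overlap A x :
  #|` overlap A x| = (\sum_(a : A) \sum_(b : A) (val b - val a == x)%R)%N.
Proof.
transitivity (\sum_(a <- A) ((a + x)%R \in A))%N.
  rewrite -big_mkcond /= big_fset_condE -card_fset_sum1; congr #|` _|.
  by apply/fsetP => a; rewrite in_overlap !inE.
rewrite big_seq_fsetE; apply: eq_bigr => a _ /=.
case: (boolP (_ \in A)) => axA.
  rewrite (bigD1 [` axA]) //= addrAC subrr add0r eqxx big1 // => b.
  rewrite -val_eqE /= => /negPf bE.
  by rewrite subr_eq addrC bE.
rewrite big1 // => b _; rewrite subr_eq addrC.
by case: eqP axA => // <-; rewrite (valP b).
Qed.

Lemma card_overlap_pairs (R : pzSemiRingType) A x :
  #|` overlap A x|%:R =
  \sum_(p : A * A) (val p.2 - val p.1 == x)%:R :> R.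
Proof. by rewrite card_overlap pair_bigA /= natr_sum. Qed.

Lemma sum_differences (R : comPzSemiRingType) A (D : seq G) (f : G -> R) :
    uniq D -> (forall a b, a \in A -> b \in A -> b - a \in D) ->
  \sum_(a : A) \sum_(b : A) f (val b - val a) =
  \sum_(x <- D) #|` overlap A x|%:R * f x.
Proof.
move=> uD AD; rewrite pair_bigA /=.
under [RHS]eq_bigr do rewrite card_overlap_pairs big_distrl /=.
rewrite [RHS]exchange_big; apply: eq_bigr => -[a b] _ /=.
by rewrite sum_delta // AD ?valP.
Qed.

Lemma energy_subset (R : realType) (s : R) A B : s != 0 -> B `<=` A ->
  energy s B =
  \sum_(x <- [fset a - b | a in A, b in A]) #|` overlap B x|%:R `^ s.
Proof.
move=> s0 /fsubsetP BA; rewrite energyE; apply: big_fset_incl => [|x _].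
  apply/fsubsetP => x /imfset2P[a /= aB [b /= bB ->]].
  by apply/imfset2P; exists a; [exact: BA|exists b => //; exact: BA].
by rewrite -overlap_neq0 negbK => /eqP ->; rewrite cardfs0 powR0.
Qed.

(** For [q = ((a, a'), (b, b'))] these are three edges of the 4-cycle a, b, a', b'. The fourth, b' -
    a, is their alternating sum, so it is not recorded. *)
Definition shape A (q : (A * A) * (A * A)) : G * G * G :=
  (val q.2.1 - val q.1.1, val q.2.1 - val q.1.2, val q.2.2 - val q.1.2).

Lemma sub_swap (a b a' b' : G) : b - a = b' - a' -> b' - b = a' - a.
Proof.
move=> h; rewrite -(subrK a' b') -h.
by rewrite addrAC [b - a]addrC addrK addrC.
Qed.

(** Two 4-cycles of equal shape are translates of each other: by [sub_swap], equal edges force all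
    four vertices to move by the same d. The fourth power of r(d) counts the pairs of 4-cycles that
    differ by d. *)
Lemma sum_same_shape_le (R : realFieldType) A (D : seq G) :
    uniq D -> (forall a b, a \in A -> b \in A -> b - a \in D) ->
  \sum_(q : (A * A) * (A * A)) \sum_(q' : (A * A) * (A * A))
    (shape q == shape q')%:R <= \sum_(d <- D) #|` overlap A d|%:R ^+ 4 :> R.
Proof.
move=> uD AD.
pose phi d (a a' : A) : R := (val a' - val a == d)%:R.
have -> : \sum_(d <- D) #|` overlap A d|%:R ^+ 4 =
    \sum_(d <- D) \sum_(q : (A * A) * (A * A)) \sum_(q' : (A * A) * (A * A))
      (phi d q.1.1 q'.1.1 * phi d q.1.2 q'.1.2) *
      (phi d q.2.1 q'.2.1 * phi d q.2.2 q'.2.2).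
  apply: eq_bigr => d _.
  rewrite (sum2_prod_mul (fun p p' => phi d p.1 p'.1 * phi d p.2 p'.2)
    (fun p p' => phi d p.1 p'.1 * phi d p.2 p'.2)).
  rewrite !sum2_prod_mul.
  have -> : \sum_a \sum_a' phi d a a' = #|` overlap A d|%:R.
    by rewrite card_overlap_pairs pair_bigA.
  ring.
rewrite [leRHS]exchange_big; apply: ler_sum => q _.
rewrite [leRHS]exchange_big; apply: ler_sum => q' _ /=.
have phi_ge0 d a a' : 0 <= phi d a a' by rewrite /phi ler0n.
rewrite /shape; case: eqP => [|_]; last by apply: sumr_ge0 => d _; rewrite !mulr_ge0.
move=> [/sub_swap h1 /sub_swap h2 /sub_swap h3].
have dD : fsval q'.1.1 - fsval q.1.1 \in D by apply: AD; exact: valP.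
(* The term of the common displacement is already 1, and the others are nonnegative. *)
rewrite (bigD1_seq _ dD uD) /= /phi /= h3 -h2 h1 !eqxx !mul1r.
by rewrite lerDl; apply: sumr_ge0 => d _; rewrite !mulr_ge0.
Qed.

Definition pair_diff A (p : A * A) : G := val p.2 - val p.1.

(** The trailing [+ 0] matches the unfolding of a sum over ['I_4]. *)
Lemma diff_relation_sum (a1 a2 a3 a4 b1 b2 b3 b4 : G) :
    (b1 - a1) - (b2 - a2) + (b3 - a3) = b4 - a4 ->
  b1 + (a2 + (b3 + (a4 + 0))) = a1 + (b2 + (a3 + (b4 + 0))).
Proof.
rewrite -{2}(subrK a1 b1) -{2}(subrK a2 b2) -{2}(subrK a3 b3) -{2}(subrK a4 b4).
move: (b1 - a1) (b2 - a2) (b3 - a3) (b4 - a4) => x1 x2 x3 x4 <-.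
(* The permutation copies the order of the left side and leaves [x2 - x2] at the end. *)
rewrite !addr0 !addrA [RHS](ACl (5*1*3*7*4*8*2*6))/=.
by rewrite addrK.
Qed.

(** Moving negative terms across turns the relation between four differences into an equation of two
    fourfold sums. This only rearranges the eight points, so it is injective, with left inverse
    [g]. *)
Lemma card_diff_relation_le A :
  (#|[set p : ((A * A) * (A * A)) * ((A * A) * (A * A)) |
      (pair_diff p.1.1 - pair_diff p.1.2 + pair_diff p.2.1 == pair_diff p.2.2)%R]%SET| <=
   T_energy 4 A)%N.
Proof.
pose t (a b c d : A) : {ffun 'I_4 -> A} := [ffun i => tnth [tuple a; b; c; d] i].
pose f (p : ((A * A) * (A * A)) * ((A * A) * (A * A))) :=
  (t p.1.1.2 p.1.2.1 p.2.1.2 p.2.2.1, t p.1.1.1 p.1.2.2 p.2.1.1 p.2.2.2).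
pose i0 : 'I_4 := ord0.
pose i1 : 'I_4 := lift ord0 ord0.
pose i2 : 'I_4 := lift ord0 (lift ord0 ord0).
pose i3 : 'I_4 := lift ord0 (lift ord0 (lift ord0 ord0)).
pose g (u : {ffun 'I_4 -> A} * {ffun 'I_4 -> A}) :=
  (((u.2 i0, u.1 i0), (u.1 i1, u.2 i1)), ((u.2 i2, u.1 i2), (u.1 i3, u.2 i3))).
have fK : cancel f g.
  by move=> [[[a b] [c d]] [[a' b'] [c' d']]]; rewrite /g /f /t /= !ffunE.
rewrite -(card_imset _ (can_inj fK)) /T_energy.
apply/subset_leq_card/fintype.subsetP => u /imsetP[p].
rewrite !inE => /eqP pE ->; rewrite !big_ord_recl !big_ord0 /= !ffunE /=.
by apply/eqP; apply: diff_relation_sum; exact: pE.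
Qed.

(** Each product counts quadruples of pairs with prescribed differences satisfying the relation
    above. Such a quadruple determines its triple [s0], so it is counted at most once. *)
Lemma sum_shape_weights_le (R : realFieldType) A (U : seq (G * G * G)) :
  uniq U ->
  \sum_(s <- U) (#|` overlap A s.1.1|%:R * #|` overlap A s.1.2|%:R) *
    (#|` overlap A s.2|%:R * #|` overlap A (s.1.1 - s.1.2 + s.2)|%:R)
  <= (T_energy 4 A)%:R :> R.
Proof.
move=> uU.
apply: le_trans (_ : _ <= #|[set p : ((A * A) * (A * A)) * ((A * A) * (A * A)) |
  (pair_diff p.1.1 - pair_diff p.1.2 + pair_diff p.2.1 == pair_diff p.2.2)%R]%SET|%:R) _;
  last by rewrite ler_nat card_diff_relation_le.
rewrite -sum1_card natr_sum.
pose chi x (p : A * A) : R := (pair_diff p == x)%:R.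
have -> : \sum_(s <- U) (#|` overlap A s.1.1|%:R * #|` overlap A s.1.2|%:R) *
    (#|` overlap A s.2|%:R * #|` overlap A (s.1.1 - s.1.2 + s.2)|%:R) =
  \sum_(s <- U) \sum_(p : ((A * A) * (A * A)) * ((A * A) * (A * A)))
    (chi s.1.1 p.1.1 * chi s.1.2 p.1.2) *
    (chi s.2 p.2.1 * chi (s.1.1 - s.1.2 + s.2) p.2.2).
  apply: eq_bigr => s _.
  rewrite (sum_prod_mul (fun p => chi s.1.1 p.1 * chi s.1.2 p.2)
    (fun p => chi s.2 p.1 * chi (s.1.1 - s.1.2 + s.2) p.2)).
  by rewrite !sum_prod_mul !card_overlap_pairs.
rewrite exchange_big [leRHS]big_mkcond; apply: ler_sum => p _ /=.
rewrite inE.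
pose s0 := (pair_diff p.1.1, pair_diff p.1.2, pair_diff p.2.1).
have chiE s : (chi s.1.1 p.1.1 * chi s.1.2 p.1.2) *
    (chi s.2 p.2.1 * chi (s.1.1 - s.1.2 + s.2) p.2.2) =
    (s0 == s)%:R * (pair_diff p.1.1 - pair_diff p.1.2 + pair_diff p.2.1 == pair_diff p.2.2)%R%:R.
  case: s => [[x y] z]; rewrite /chi /s0 !xpair_eqE /=.
  do 3 (case: eqP => [<-|_]; rewrite ?mul0r ?mulr0 ?mul1r //).
  by rewrite eq_sym.
under eq_bigr do rewrite chiE.
have [sU|sU] := boolP (s0 \in U).
  by rewrite sum_delta //; case: eqP.
rewrite big_seq big1 => [|s sinU]; first by case: ifP.
by case: eqP sU => [->|_ _]; rewrite ?sinU ?mul0r.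
Qed.

(** The 4-cycle bound is squared, whence the exponent 8, and the square of [W] is bounded by
    grouping 4-cycles by shape. *)
Lemma energy32_le_energy4 (R : rcfType) A (D : seq G) :
    uniq D -> (forall a b, a \in A -> b \in A -> b - a \in D) ->
  (\sum_(x <- D) #|` overlap A x|%:R * Num.sqrt #|` overlap A x|%:R) ^+ 8 <=
  #|` A|%:R ^+ 8 * (\sum_(d <- D) #|` overlap A d|%:R ^+ 4) *
    (T_energy 4 A)%:R :> R.
Proof.
move=> uD AD.
pose w x : R := Num.sqrt #|` overlap A x|%:R.
pose k (a b : A) := w (val b - val a).
pose F (s : G * G * G) :=
  (w s.1.1 * w s.1.2) * (w s.2 * w (s.1.1 - s.1.2 + s.2)).
rewrite -(sum_differences w uD AD).
have := sum_four_cycles_ge k.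
set S := \sum_a _; rewrite -cardfE.
have -> : \sum_(p : A * A) (\sum_b k p.1 b * k p.2 b) ^+ 2 =
    \sum_(q : (A * A) * (A * A)) F (shape q).
  rewrite -(pair_bigA _ (fun p r => F (shape (p, r)))) /=.
  apply: eq_bigr => p _.
  rewrite expr2 big_distrlr pair_bigA; apply: eq_bigr => r _ /=.
  rewrite /F /shape /k /=.
  have -> : val r.1 - val p.1 - (val r.1 - val p.2) + (val r.2 - val p.2) =
      val r.2 - val p.1.
    have h (u v z : G) : u - v - (u - z) = z - v.
      by rewrite opprB addrC addrA subrK.
    by rewrite h addrC addrA subrK.
  by rewrite /=; ring.
set W := \sum_q _ => SW.
have W0 : 0 <= W by apply: sumr_ge0 => q _; rewrite !mulr_ge0 ?sqrtr_ge0.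
have W2 : W ^+ 2 <= (\sum_(d <- D) #|` overlap A d|%:R ^+ 4) * (T_energy 4 A)%:R.
  apply: le_trans (sum_fibers_sqr_le _ _) _.
  apply: ler_pM.
  - by do 2 (apply: sumr_ge0 => ? _); rewrite ler0n.
  - by apply: sumr_ge0 => ? _; rewrite sqr_ge0.
  - exact: sum_same_shape_le.
  apply: le_trans (sum_shape_weights_le _ _ (undup_uniq _)).
  (* Squaring [F] removes the square roots and leaves the product of four overlap sizes. *)
  by apply: ler_sum => s _; rewrite /F !exprMn !sqr_sqrtr ?ler0n.
rewrite -mulrA (exprM S 4 2).
apply: (@le_trans _ _ ((#|` A|%:R ^+ 4 * W) ^+ 2)).
  rewrite lerXn2r ?nnegrE //; last by rewrite mulr_ge0 ?exprn_ge0.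
  by rewrite (exprM S 2 2) sqr_ge0.
by rewrite exprMn -exprM ler_wpM2l ?exprn_ge0.
Qed.

(** * Moments of overlap sizes and the Minkowski bound for E_4 *)

Lemma sum_card_overlap (R : comPzSemiRingType) A (D : seq G) :
    uniq D -> (forall a b, a \in A -> b \in A -> b - a \in D) ->
  \sum_(x <- D) #|` overlap A x|%:R = #|` A|%:R ^+ 2 :> R.
Proof.
move=> uD AD; under eq_bigr do rewrite -[_%:R]mulr1.
rewrite -(sum_differences (fun=> 1)) //.
by rewrite !sumr_const -cardfE expr2 mulr_natr.
Qed.

(* [#|overlap A d|^2] is the sum over [x] of [#|overlap (overlap A x) d|], so
   this is Minkowski's inequality in the Hilbert space of functions of [d]. *)
Lemma sqrt_energy4_le (R : rcfType) A (D : seq G) :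
    uniq D -> (forall a b, a \in A -> b \in A -> b - a \in D) ->
  Num.sqrt (\sum_(d <- D) #|` overlap A d|%:R ^+ 4) <=
  \sum_(x <- D) Num.sqrt
    (\sum_(d <- D) #|` overlap (overlap A x) d|%:R ^+ 2) :> R.
Proof.
move=> uD AD; set E4 := \sum_(d <- D) _ ^+ 4; set S := \sum_(x <- D) _.
have E40 : 0 <= E4 by apply: sumr_ge0 => d _; rewrite exprn_ge0.
have S0 : 0 <= S by apply: sumr_ge0 => d _; rewrite sqrtr_ge0.
have ES : E4 <= S * Num.sqrt E4.
  have E4E : E4 = \sum_(x <- D) \sum_(d <- D)
      #|` overlap (overlap A x) d|%:R * #|` overlap A d|%:R ^+ 2.
    rewrite exchange_big; apply: eq_bigr => d _ /=.
    rewrite -big_distrl /= (exprD _ 2 2); congr (_ * _).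
    under eq_bigr do rewrite overlapC.
    rewrite (sum_card_overlap _ uD) // => a b aB bB.
    by apply: AD; apply: (fsubsetP (overlap_sub A d)).
  rewrite {1}E4E big_distrl /=; apply: ler_sum => x _.
  rewrite -sqrtrM; last by apply: sumr_ge0 => d _; rewrite sqr_ge0.
  apply: le_trans (ler_norm _) _; rewrite -sqrtr_sqr ler_wsqrtr //.
  apply: le_trans (sum_cauchy_schwarz _ _ _) _.
  by under [X in _ * X]eq_bigr do rewrite -(exprM _ 2 2).
have [/eqP ->//|E4gt0] := boolP (Num.sqrt E4 == 0).
have {}E4gt0 : 0 < Num.sqrt E4 by rewrite lt_def E4gt0 sqrtr_ge0.
by rewrite -(ler_pM2r E4gt0) -[X in X <= _]expr2 sqr_sqrtr.
Qed.

Lemma sum_overlap_sqr_le (R : realFieldType) A (D : seq G) :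
    uniq D -> (forall a b, a \in A -> b \in A -> b - a \in D) ->
  \sum_(x <- D) #|` overlap A x|%:R ^+ 2 <= #|` A|%:R ^+ 3 :> R.
Proof.
move=> uD AD; rewrite exprS -(sum_card_overlap _ uD AD) big_distrr /=.
apply: ler_sum => x _; rewrite expr2 ler_wpM2r // ler_nat.
exact/fsubset_leq_card/overlap_sub.
Qed.

End Overlaps.

(** * Choice of A' among the overlaps *)

Lemma powR_three_half (R : realType) (x : R) : 0 <= x ->
  x `^ (3 / 2) = x * Num.sqrt x.
Proof.
move=> x0; have -> : 3 / 2 = 1 + 2^-1 :> R by lra.
rewrite powRD ?powRr1 ?powR12_sqrt //.
by apply/implyP => /eqP; lra.
Qed.

Theorem theorem4 (R : realType) :
  exists c : R, 0 < c /\
    forall (G : zmodType) (A : {fset G}) (K M : R),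
      A != fset0 ->
      0 < K ->
      energy (3 / 2) A = #|` A|%:R `^ (5 / 2) / K `^ (1 / 2) ->
      (T_energy 4 A)%:R = M * #|` A|%:R ^+ 7 / K ^+ 3 ->
      exists A' : {fset G},
        [/\ A' `<=` A,
            #|` A'|%:R >= c * (#|` A|%:R / (M * K)) &
            energy 2 A' >= c * (#|` A'|%:R ^+ 3 / M)].
Proof.
(* The square root of [1 / 16] makes each of the two final error terms a quarter of the main
   term. *)
exists (1 / 16); split=> [|G A K M A0 K0 EA TA]; first by lra.
pose D : seq G := [fset a - b | a in A, b in A].
have uD : uniq D by exact: fset_uniq.
have AD a b : a \in A -> b \in A -> b - a \in D.
  by move=> aA bA; apply/imfset2P; exists b => //; exists a.
have BD x a b : a \in overlap A x -> b \in overlap A x -> b - a \in D.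
  by move=> aB bB; apply: AD; apply: (fsubsetP (overlap_sub A x)).
pose n : R := #|` A|%:R.
pose r x : R := #|` overlap A x|%:R.
pose e x : R := \sum_(d <- D) #|` overlap (overlap A x) d|%:R ^+ 2.
have n0 : 0 < n by rewrite ltr0n cardfs_gt0.
have r0 x : 0 <= r x by exact: ler0n.
have eE x : energy 2 (overlap A x) = e x.
  rewrite (energy_subset _ (overlap_sub A x)) ?pnatr_eq0 //.
  by apply: eq_bigr => d _; rewrite powR_mulrn.
have e0 x : 0 <= e x by apply: sumr_ge0 => d _; rewrite sqr_ge0.
pose E3 := \sum_(x <- D) r x * Num.sqrt (r x).
have E3_0 : 0 <= E3 by apply: sumr_ge0 => x _; rewrite mulr_ge0 ?sqrtr_ge0.
have E3sqr : E3 ^+ 2 = n ^+ 5 / K.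
  have <- : energy (3 / 2) A = E3.
    by rewrite energyE; apply: eq_bigr => x _; rewrite powR_three_half.
  rewrite EA expr_div_n -!powR_mulrn ?powR_ge0 ?(ltW n0) // -!powRrM.
  rewrite !divfK ?pnatr_eq0 // powRr1 ?(ltW K0) //.
pose E4 := \sum_(d <- D) r d ^+ 4.
have E40 : 0 <= E4 by apply: sumr_ge0 => d _; rewrite exprn_ge0.
(* By [E3sqr] the eighth power of [E3] is [(n ^+ 5 / K) ^+ 4]; the positive factor
   [n ^+ 15 / K ^+ 4] then cancels. *)
have E4M : n ^+ 5 <= E4 * (M * K).
  have := energy32_le_energy4 R uD AD.
  rewrite -/n -/E3 -/E4 TA (exprM _ 2 4) E3sqr -/n.
  have -> : (n ^+ 5 / K) ^+ 4 = n ^+ 15 / K ^+ 4 * n ^+ 5.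
    by field; rewrite gt_eqF.
  have -> : n ^+ 8 * E4 * (M * n ^+ 7 / K ^+ 3) =
      n ^+ 15 / K ^+ 4 * (E4 * (M * K)) by field; rewrite gt_eqF.
  by rewrite ler_pM2l // divr_gt0 ?exprn_gt0.
(* [E4 >= 0] and [n ^+ 5 > 0] in [E4M] rule out [M * K <= 0]. *)
have M0 : 0 < M.
  rewrite -(pmulr_lgt0 _ K0) ltNge; apply/negP => MK.
  have := lt_le_trans (exprn_gt0 5 n0) E4M.
  by rewrite ltNge mulr_ge0_le0.
have MK0 : 0 < M * K by rewrite mulr_gt0.
pose good x := (1 / 16 * (n / (M * K)) <= r x) && (1 / 16 * (r x ^+ 3 / M) <= e x).
have [/hasP[x _ /andP[rx ex]]|/hasPn bad] := boolP (has good D).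
  by exists (overlap A x); rewrite overlap_sub eE.
exfalso.
pose al := Num.sqrt (1 / 16 * (n / (M * K))).
pose be := Num.sqrt (1 / 16 / M).
have sqrt_r3 x : Num.sqrt (r x ^+ 3) = r x * Num.sqrt (r x).
  by rewrite exprSr sqrtrM ?sqr_ge0 // sqrtr_sqr ger0_norm.
(* A bad x fails the size bound, and the trivial [e x <= r x ^+ 3] gives the first term, or it fails
   the energy bound, which gives the second. *)
have ebound x : x \in D -> Num.sqrt (e x) <= al * r x + be * (r x * Num.sqrt (r x)).
  move=> /bad; rewrite /good negb_and -!ltNge => /orP[rx|ex].
    apply: (@le_trans _ _ (al * r x)); last first.
      by rewrite lerDl !mulr_ge0 ?sqrtr_ge0.
    apply: (@le_trans _ _ (Num.sqrt (r x ^+ 3))).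
      by apply: ler_wsqrtr; apply: sum_overlap_sqr_le => //; exact: BD.
    by rewrite sqrt_r3 mulrC ler_wpM2r // ler_wsqrtr // ltW.
  apply: (@le_trans _ _ (be * (r x * Num.sqrt (r x)))); last first.
    by rewrite lerDr mulr_ge0 ?sqrtr_ge0.
  rewrite -sqrt_r3 /be -sqrtrM ?divr_ge0 ?(ltW M0) //.
  by apply: ler_wsqrtr; rewrite mulrAC -[1 / 16 * _ / M]mulrA ltW.
pose X := Num.sqrt (n ^+ 5 / (M * K)).
have X0 : 0 < X by rewrite sqrtr_gt0 divr_gt0 ?exprn_gt0.
have QX : X <= Num.sqrt E4 by rewrite ler_wsqrtr // ler_pdivrMr.
have alX : al * n ^+ 2 = X / 4.
  apply/eqP; rewrite -(eqrXn2 (n := 2)) //; first apply/eqP.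
  - rewrite exprMn sqr_sqrtr ?mulr_ge0 ?invr_ge0 ?(ltW MK0) ?(ltW n0) //.
    rewrite expr_div_n sqr_sqrtr ?divr_ge0 ?exprn_ge0 ?(ltW MK0) ?(ltW n0) //.
    by field; rewrite !gt_eqF.
  - by rewrite mulr_ge0 ?sqrtr_ge0 ?sqr_ge0.
  - by rewrite divr_ge0 ?sqrtr_ge0.
have beX : be * E3 = X / 4.
  apply/eqP; rewrite -(eqrXn2 (n := 2)) //; first apply/eqP.
  - rewrite exprMn E3sqr sqr_sqrtr ?divr_ge0 ?(ltW M0) //.
    rewrite expr_div_n sqr_sqrtr ?divr_ge0 ?exprn_ge0 ?(ltW MK0) ?(ltW n0) //.
    by field; rewrite !gt_eqF.
  - by rewrite mulr_ge0 ?sqrtr_ge0.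
  - by rewrite divr_ge0 ?sqrtr_ge0.
(* Summing [ebound] over [D] gives [X <= X / 4 + X / 4], impossible for [X > 0]. *)
have : Num.sqrt E4 <= al * n ^+ 2 + be * E3.
  apply: le_trans (sqrt_energy4_le R uD AD) _.
  rewrite -(sum_card_overlap R uD AD) !big_distrr -big_split /=.
  by rewrite big_seq [leRHS]big_seq; apply: ler_sum; exact: ebound.
by rewrite alX beX; lra.
Qed.
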